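(* Let $\mathcal H_K$ be a reproducing kernel Hilbert space of complex-valued functions on a set $D$ with bounded kernel $K$, and let $R:=\sup_{x\in D}\sqrt{K(x,x)}<\infty$. Then for all $n\in\mathbb N$ $$g_{2n}^{\mathrm{lin}}(B_{\mathcal H_K})_\infty\le\sqrt{8R\,c_n(B_{\mathcal H_K})_\infty}.$$
   Context: $B(D)$ is the space of bounded functions $D\to\mathbb C$ with norm $\|f\|_\infty=\sup_{x\in D}|f(x)|$. $\mathcal H_K$ is the reproducing kernel Hilbert space (RKHS) on $D$ with kernel $K\colon D\times D\to\mathbb C$, i.e. $f(x)=\langle f,K(\cdot,x)\rangle_{\mathcal H_K}$ for all $f\in\mathcal H_K$, $x\in D$. The kernel is bounded if $R<\infty$; then $\mathcal H_K$ embeds continuously into $B(D)$. $B_{\mathcal H_K}$ is the unit ball of $\mathcal H_K$. Gelfand widths: for $n\ge1$, $$c_n(B_{\mathcal H_K})_\infty:=\inf_{\psi,N}\ \sup_{f\in B_{\mathcal H_K}}\|f-\psi(Nf)\|_\infty,$$ the infimum over all bounded linear maps $N\colon\mathcal H_K\to\mathbb C^n$ and all (arbitrary, possibly non-linear) maps $\psi\colon\mathbb C^n\to B(D)$. Linear sampling widths: for $m\ge1$, $$g_m^{\mathrm{lin}}(B_{\mathcal H_K})_\infty:=\inf_{x_1,\dots,x_m\in D,\ \varphi}\ \sup_{f\in B_{\mathcal H_K}}\|f-\varphi(f(x_1),\dots,f(x_m))\|_\infty,$$ the infimum over all points and all linear maps $\varphi\colon\mathbb C^m\to B(D)$. *)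

(* Defs.v *)
From HB Require Import structures.
From mathcomp Require Import all_boot all_order all_algebra.
From mathcomp Require Import sesquilinear.
From mathcomp Require Import complex.
From mathcomp Require Import all_classical all_reals all_analysis.

Set Implicit Arguments.
Unset Strict Implicit.
Unset Printing Implicit Defensive.

Import Order.TTheory GRing.Theory Num.Theory.
Import numFieldNormedType.Exports.

Local Open Scope classical_set_scope.
Local Open Scope complex_scope.
Local Open Scope ring_scope.

(* A Hilbert space of functions on D is given by an abstract complete space
   together with an injective linear map [rkhs_eval] sending each element to
   the function that it is.  The inner product is linear in its first argument
   and conjugate-linear in the second. *)
Record rkhs (R : realType) (D : Type) (K : D -> D -> R[i]) := RKHS {
  rkhs_space :> completeNormedModType R[i] ;
  rkhs_dot : {dot rkhs_space for (@Num.conj R[i])} ;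
  rkhs_eval : {linear rkhs_space -> (D -> R[i])} ;
  rkhs_normE : forall f : rkhs_space, `|f| ^+ 2 = rkhs_dot f f ;
  rkhs_eval_inj : injective rkhs_eval ;
  rkhs_reproducing : forall x : D, exists2 k : rkhs_space,
    rkhs_eval k = (fun y => K y x) &
    forall f : rkhs_space, rkhs_eval f x = rkhs_dot f k }.

Section widths.
Variables (R : realType) (D : Type).
Local Notation C := R[i].

Definition supnorm (g : D -> C) : \bar R :=
  ereal_sup [set (ComplexField.Normc.normc (g x))%:E | x in [set: D]].

(* The diagonal of a reproducing kernel is real and nonnegative, so taking its
   real part loses nothing. *)
Definition kernel_bound (K : D -> D -> C) : \bar R :=
  ereal_sup [set (Num.sqrt (complex.Re (K x x)))%:E | x in [set: D]].

Variables (K : D -> D -> C) (H : rkhs K).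

Definition unit_ball : set H := [set f | `|f| <= 1].

Definition bounded_op n (N : H -> 'cV[C]_n) : Prop :=
  exists M : C, forall f : H, `|N f| <= M * `|f|.

Definition gelfand_width (n : nat) : \bar R :=
  ereal_inf [set e | exists (N : {linear H -> 'cV[C]_n})
                            (psi : 'cV[C]_n -> (D -> C)),
    [/\ bounded_op N,
        forall v, bounded_fun (psi v : D -> C^o) &
        e = ereal_sup [set supnorm (rkhs_eval H f - psi (N f))
                      | f in unit_ball]]].

Definition linear_sampling_width (m : nat) : \bar R :=
  ereal_inf [set e | exists (x : 'I_m -> D)
                            (phi : {linear 'cV[C]_m -> (D -> C)}),
    (forall v, bounded_fun (phi v : D -> C^o)) /\
    e = ereal_sup [set supnorm (rkhs_eval H f
                                - phi (\col_(i < m) rkhs_eval H f (x i)))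
                  | f in unit_ball]].

End widths.

(* Main.v *)
(* Write K_x for the kernel section at x, so that f(x) = <f, K_x>.  Sampling at
   points y_i linearly amounts to approximating every K_x by elements of
   span{K_{y_i}}.  Take 2n points whose Gram determinant is maximal up to a
   factor 2, let d be the distance of some K_x to that span, and let G be the
   Gram matrix of the 2n+1 vectors f_i obtained by adding K_x.  Then
   (G^-1)_ii = det G_{-i} / det G <= 2/d^2 for all i, and the i-th coefficient
   of u in the basis (f_i) is at most sqrt((G^-1)_ii) |u|.  An information map N
   of rank n has a kernel W of dimension at least n+1 in span{f_i}; if
   |f(x)| <= c |f| on ker N, then the projection of f_i onto W has norm at most
   c, so the trace of that projection gives n+1 <= (2n+1) c sqrt(2)/d, whence
   d <= sqrt(8) c.  Since also c <= R may be assumed, d^2 <= 8 R c.  If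
   there are no 2n independent sections, a maximal independent family spans all
   of them. *)
Require Import Defs.
From HB Require Import structures.
From mathcomp Require Import all_boot all_order all_algebra.
From mathcomp Require Import complex perm sesquilinear ring lra zify.
From mathcomp Require Import all_classical all_reals all_analysis.

Set Implicit Arguments.
Unset Strict Implicit.
Unset Printing Implicit Defensive.

Import Order.TTheory GRing.Theory Num.Theory.
Import numFieldNormedType.Exports.

Local Open Scope classical_set_scope.
Local Open Scope complex_scope.
Local Open Scope ring_scope.
Local Open Scope sesquilinear_scope.

(** * Gram matrices of a positive definite Hermitian form *)

Section Gram.
Variables (C : numClosedFieldType) (U : lmodType C).
Variable form : {dot U for (@Num.conj C)}.
Local Notation "''[' u , v ]" := (form u%R v%R) : ring_scope.
Local Notation "''[' u ]" := '[u, u] : ring_scope.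

Lemma dot_conjC u v : '[u, v] = '[v, u]^*.
Proof. by rewrite hermC mul1r. Qed.

Lemma dotZl a u v : '[a *: u, v] = a * '[u, v].
Proof. exact: linearZl_LR. Qed.

Lemma dotZr a u v : '[u, a *: v] = a^* * '[u, v].
Proof. exact: linearZr_LR. Qed.

Lemma dot_CauchySchwarz u v : `|'[u, v]| ^+ 2 <= '[u] * '[v].
Proof.
have [->|v0] := eqVneq v 0; first by rewrite !linear0r normr0 expr0n.
have vp : 0 < '[v] by rewrite dnorm_gt0.
have := dnorm_ge0 form ('[v] *: u - '[u, v] *: v).
rewrite dnormB !dnormZ dotZl dotZr rmorphM /= rmorphM /= conjCK.
rewrite -(dot_conjC v v) (ger0_norm (ltW vp)).
have -> : '[v] ^+ 2 * '[u] + `|'[u, v]| ^+ 2 * '[v] -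
  ('[v] * ('[u, v]^* * '[u, v]) + '[v] * ('[u, v] * '[u, v]^*)) =
  '[v] * ('[u] * '[v] - `|'[u, v]| ^+ 2).
  by rewrite normCK; ring.
by rewrite pmulr_rge0// subr_ge0.
Qed.

Lemma dnormB_le u v : '[u - v] <= 2 * ('[u] + '[v]).
Proof.
rewrite -subr_ge0; have := dnorm_ge0 form (u + v).
by rewrite dnormB dnormD; congr (_ <= _); ring.
Qed.

Section Family.
Variables (m : nat) (f : 'I_m -> U).

Definition gram : 'M[C]_m := \matrix_(i, j) '[f i, f j].
Definition lincomb (a : 'rV[C]_m) : U := \sum_j a 0 j *: f j.

Lemma lincombZ c a : lincomb (c *: a) = c *: lincomb a.
Proof.
by rewrite /lincomb scaler_sumr; apply: eq_bigr => j _; rewrite mxE scalerA.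
Qed.

Lemma lincomb_delta i : lincomb (delta_mx 0 i) = f i.
Proof.
rewrite /lincomb (bigD1 i)//= mxE !eqxx scale1r big1 ?addr0// => j ji.
by rewrite mxE (negPf ji) andbF scale0r.
Qed.

Lemma dot_lincombl a v : '[lincomb a, v] = \sum_j a 0 j * '[f j, v].
Proof.
by rewrite linear_sumlz; apply: eq_bigr => j _; exact: dotZl.
Qed.

Lemma dot_lincomb_vec a i : '[lincomb a, f i] = (a *m gram) 0 i.
Proof. by rewrite dot_lincombl mxE; apply: eq_bigr => j _; rewrite mxE. Qed.

Lemma dot_lincomb a b :
  '[lincomb a, lincomb b] = (a *m gram *m b ^t Num.conj) 0 0.
Proof.
rewrite /(lincomb b) linear_sumr mxE; apply: eq_bigr => j _.
by rewrite [LHS]dotZr dot_lincomb_vec !mxE mulrC.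
Qed.

(** If [a *m gram = 0], then [lincomb a] is orthogonal to itself, hence zero by definiteness. *)
Lemma gram_unitmxP :
  reflect (forall a, lincomb a = 0 -> a = 0) (gram \in unitmx).
Proof.
apply: (iffP idP) => [Gu a a0|free].
  rewrite -(mulmxK Gu a); suff -> : a *m gram = 0 by rewrite mul0mx.
  by apply/rowP => j; rewrite -dot_lincomb_vec a0 linear0l mxE.
rewrite -row_free_unit -kermx_eq0; apply/rowV0P => a /sub_kermxP aG.
by apply: free; apply/eqP; rewrite -(dnorm_eq0 form) dot_lincomb aG mul0mx mxE.
Qed.

Hypothesis Gu : gram \in unitmx.

(** Coefficients of the i-th vector of the dual (biorthogonal) basis; the conjugation matches the
    conjugate-linear second argument of the form. *)
Definition gram_dual i : 'rV[C]_m := (col i (invmx gram)) ^t Num.conj.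

Lemma dot_gram_dual (a : 'rV[C]_m) i :
  '[lincomb a, lincomb (gram_dual i)] = a 0 i.
Proof.
rewrite dot_lincomb -[in RHS](mulmxK Gu a) [LHS]mxE [RHS]mxE.
by apply: eq_bigr => j _; rewrite !mxE conjCK.
Qed.

Lemma dnorm_gram_dual i : '[lincomb (gram_dual i)] = invmx gram i i.
Proof.
apply/(can_inj (@conjCK C)); rewrite -dot_conjC dot_gram_dual.
by rewrite !mxE.
Qed.

Lemma invmx_gram_gt0 i : 0 < invmx gram i i.
Proof.
rewrite -dnorm_gram_dual dnorm_gt0; apply/eqP => g0.
have := dot_gram_dual (delta_mx 0 i) i.
by rewrite g0 linear0r mxE !eqxx => /esym/eqP; rewrite oner_eq0.
Qed.

(** Cauchy-Schwarz against the dual vector, which reads off the i-th coefficient. *)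
Lemma coef_lincomb_le (a : 'rV[C]_m) i :
  `|a 0 i| ^+ 2 <= invmx gram i i * '[lincomb a].
Proof.
by rewrite -(dot_gram_dual a i) -dnorm_gram_dual mulrC dot_CauchySchwarz.
Qed.

(* The dual vector rescaled to have i-th coefficient 1 is the component of
   [f i] orthogonal to the other vectors; its squared norm is the inverse of
   the diagonal entry. *)
Lemma invmx_gram_dist i t :
    (forall a : 'rV[C]_m, a 0 i = 1 -> t < '[lincomb a]) ->
  invmx gram i i * t < 1.
Proof.
set w := invmx gram i i => dist_f; have w0 : 0 < w := invmx_gram_gt0 i.
have wR : w^* = w by rewrite geC0_conj // ltW.
have := dist_f (w^-1 *: gram_dual i).
rewrite lincombZ dnormZ dnorm_gram_dual -/w !mxE -/w wR mulVf ?gt_eqF//.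
move=> /(_ erefl).
rewrite ger0_norm ?invr_ge0 ?ltW// expr2 -mulrA mulVf ?gt_eqF// mulr1.
by rewrite -(ltr_pM2l w0) mulfV ?gt_eqF.
Qed.

(* The trace of the orthogonal projection onto the subspace of combinations
   with coefficients in [kermx M] is its dimension, at least m - n; its i-th
   diagonal coefficient in the basis f is bounded by w. *)
Lemma gram_dim_le n (M : 'M[C]_(m, n)) (e w : C) : 0 <= e -> 0 <= w ->
    (forall a, a *m M = 0 -> forall i,
       `|'[lincomb a, f i]| ^+ 2 <= e * '[lincomb a]) ->
    (forall i, invmx gram i i * e <= w ^+ 2) ->
  (m - n)%:R <= m%:R * w.
Proof.
move=> e0 w0 evM diag.
(* The rows of [B] form a basis of the coefficient space [kermx M]; [S] below is the Gram matrix of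
   the corresponding vectors. *)
pose B := row_base (kermx M); set p := \rank (kermx M) in B *.
have BM : B *m M = 0 by apply/sub_kermxP; rewrite eq_row_base.
pose S := B *m gram *m B ^t Num.conj.
have Su : S \in unitmx.
  rewrite -row_free_unit -kermx_eq0; apply/rowV0P => v /sub_kermxP vS.
  have : '[lincomb (v *m B)] = 0.
    rewrite dot_lincomb trmx_mul map_mxM /=.
    have -> : v *m B *m gram *m (B ^t Num.conj *m v ^t Num.conj) =
      v *m S *m v ^t Num.conj by rewrite !mulmxA.
    by rewrite vS mul0mx mxE.
  move/eqP; rewrite dnorm_eq0 => /eqP /(elimT gram_unitmxP Gu) vB.
  by apply: (row_free_inj (row_base_free (kermx M))); rewrite mul0mx.
(* Row i of [P] holds the coefficients of the orthogonal projection of [f i] onto the span of these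
   vectors. *)
pose Q := gram *m B ^t Num.conj *m invmx S; pose P := Q *m B.
have trP : \tr P = p%:R.
  by rewrite mxtrace_mulC /Q !mulmxA mulmxV // mxtrace1.
have pm : (m - n <= p)%N by rewrite /p mxrank_ker leq_sub2l // rank_leq_col.
apply: (@le_trans _ _ p%:R); first by rewrite ler_nat.
have Pw i : `|P i i| <= w.
  pose a := row i P; have aE : a = row i Q *m B by rewrite -row_mul.
  have aM : a *m M = 0 by rewrite aE -mulmxA BM mulmx0.
  have adot : '[lincomb a] = '[f i, lincomb a].
    have aB : a *m gram *m B ^t Num.conj =
        delta_mx 0 i *m gram *m B ^t Num.conj.
      have QS : Q *m S = gram *m B ^t Num.conj by rewrite mulmxKV.
      by rewrite -[RHS]mulmxA -rowE -QS row_mul /S aE !mulmxA.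
    rewrite -(lincomb_delta i) !dot_lincomb.
    have -> : a ^t Num.conj = B ^t Num.conj *m (row i Q) ^t Num.conj.
      by rewrite aE trmx_mul map_mxM.
    by rewrite !mulmxA aB.
  (* By [adot] the hypothesis [evM] becomes ['[lincomb a] ^+ 2 <= e * '[lincomb a]]. *)
  have ae : '[lincomb a] <= e.
    have := evM a aM i; rewrite (dot_conjC (lincomb a)) -adot norm_conjC.
    rewrite ger0_norm // expr2; have [->|a0] := eqVneq (lincomb a) 0.
      by rewrite linear0l.
    by rewrite ler_pM2r // dnorm_gt0.
  rewrite -ler_sqr ?nnegrE // (le_trans _ (diag i)) //.
  have -> : P i i = a 0 i by rewrite [RHS]mxE.
  apply: (le_trans (coef_lincomb_le a i)).
  by rewrite ler_pM2l // invmx_gram_gt0.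
rewrite -trP -[leLHS]ger0_norm ?trP // -trP.
apply: (le_trans (ler_norm_sum _ _ _)).
apply: (@le_trans _ _ (\sum_(i < m) w)); first exact: ler_sum.
by rewrite sumr_const card_ord mulr_natl.
Qed.
End Family.

(** Cramer's rule. The entry is positive, so absolute values can be taken without first showing Gram
    determinants nonnegative. *)
Lemma norm_invmx_gram m (f : 'I_m.+1 -> U) i :
    gram f \in unitmx ->
  invmx (gram f) i i = `|\det (gram (f \o lift i))| / `|\det (gram f)|.
Proof.
move=> Gu; rewrite -[LHS]ger0_norm ?ltW ?invmx_gram_gt0 //.
rewrite /invmx Gu !mxE normrM normfV mulrC /cofactor addnn.
rewrite -signr_odd odd_double mul1r; congr (`|\det _| / _).
by apply/matrixP => j l; rewrite !mxE.
Qed.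

(** A dependency involving [f ord0] could be scaled to coefficient 1 there, giving squared norm 0
    where more than [t] is required. *)
Lemma gram_extend m (f : 'I_m.+1 -> U) t :
    0 <= t -> gram (f \o lift ord0) \in unitmx ->
    (forall a : 'rV[C]_m.+1, a 0 ord0 = 1 -> t < '[lincomb f a]) ->
  gram f \in unitmx.
Proof.
move=> t0 /gram_unitmxP free dist_f; apply/gram_unitmxP => a a0.
have [a00|a00] := eqVneq (a 0 ord0) 0; last first.
  have := dist_f ((a 0 ord0)^-1 *: a).
  rewrite mxE mulVf // lincombZ a0 scaler0 linear0l => /(_ erefl).
  by move=> /(le_lt_trans t0); rewrite ltxx.
pose b := \row_j a 0 (lift ord0 j).
have b0 : b = 0.
  apply: free; rewrite -a0 /lincomb big_ord_recl a00 scale0r add0r.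
  by apply: eq_bigr => j _; rewrite mxE.
apply/rowP => j; rewrite mxE; case: (unliftP ord0 j) => [l ->|-> //].
by move/rowP: b0 => /(_ l); rewrite !mxE.
Qed.

(* Goreinov-Tyrtyshnikov maximal volume argument. *)
Lemma gram_maxvol m (f : 'I_m.+1 -> U) t :
    0 <= t -> gram (f \o lift ord0) \in unitmx ->
    (forall a : 'rV[C]_m.+1, a 0 ord0 = 1 -> t < '[lincomb f a]) ->
    (forall i, `|\det (gram (f \o lift i))| <=
       2 * `|\det (gram (f \o lift ord0))|) ->
  forall i, invmx (gram f) i i * t <= 2.
Proof.
move=> t0 gu dist_f maxvol i.
have Gu := gram_extend t0 gu dist_f.
(* This is the case [i = ord0], with bound 1; passing to another [i] costs the factor 2 of
   [maxvol]. *)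
have := ltW (invmx_gram_dist Gu dist_f).
rewrite !norm_invmx_gram // => le1.
have /le_trans -> // :
  `|\det (gram (f \o lift i))| / `|\det (gram f)| * t <=
  2 * (`|\det (gram (f \o lift ord0))| / `|\det (gram f)| * t).
  rewrite !mulrA ler_wpM2r // ler_wpM2r ?invr_ge0 //.
by rewrite -[leRHS]mulr1 ler_wpM2l.
Qed.

(** A crude Leibniz bound; it serves only to make the supremum of Gram determinants finite. *)
Lemma norm_det_gram_le m (f : 'I_m -> U) r :
  0 <= r -> (forall i, '[f i] <= r) -> `|\det (gram f)| <= m`!%:R * r ^+ m.
Proof.
move=> r0 fr; apply: (le_trans (ler_norm_sum _ _ _)).
apply: (@le_trans _ _ (\sum_(s : 'S_m) r ^+ m)); last first.
  by rewrite sumr_const card_Sn mulr_natl.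
apply: ler_sum => s _; rewrite normrM normrX normrN1 expr1n mul1r normr_prod.
rewrite -[X in r ^+ X]card_ord -prodr_const.
apply: ler_prod => i _; rewrite normr_ge0 mxE /=.
rewrite -ler_sqr ?nnegrE // (le_trans (dot_CauchySchwarz _ _)) // expr2.
by rewrite ler_pM.
Qed.
End Gram.

(** * Choice of points with nearly maximal Gram determinant *)

Lemma ex_near_max (R : realType) (T : Type) (F : T -> R) (B : R) (z0 : T) :
    0 < F z0 -> (forall z, F z <= B) ->
  exists2 y, 0 < F y & forall z, F z <= 2 * F y.
Proof.
move=> Fz0 FB; pose s := sup (range F).
have hs : has_sup (range F).
  by split; [exists (F z0), z0 | exists B => _ [z _ <-]].
have ub z : F z <= s by apply: ub_le_sup; [exact: hs.2 | exists z].
have s0 : 0 < s by exact: lt_le_trans (ub z0).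
(* The supremum may not be attained, but any value above half of it will do. *)
have [|_ [y _ <-] sy] := @sup_adherent _ (range F) (s / 2) _ hs.
  by rewrite divr_gt0.
rewrite -/s in sy.
 exists y => [|z]; last by have := ub z; lra.
lra.
Qed.

Section Points.
Variables (R : realType) (D : Type).
Local Notation C := R[i].
Variables (U : lmodType C) (form : {dot U for (@Num.conj C)}) (k : D -> U).
Local Notation "''[' u , v ]" := (form u%R v%R) : ring_scope.
Local Notation "''[' u ]" := '[u, u] : ring_scope.

Definition independent m (y : 'I_m -> D) := gram form (k \o y) \in unitmx.

Lemma ex_maximal_independent M :
  exists m, (m <= M)%N /\ (exists y : 'I_m -> D, independent y) /\
    (m = M \/ forall z : 'I_m.+1 -> D, ~ independent z).
Proof.
elim: M => [|M [m [mM [[y yi] max]]]].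
  exists 0; split=> //; split; last by left.
  suff [y] : inhabited ('I_0 -> D).
    by exists y; rewrite /independent unitmxE det_mx00 unitr1.
  by constructor; case.
have [[z zi]|no] := pselect (exists z : 'I_m.+1 -> D, independent z);
  last first.
  exists m; split; [exact: leqW|split; [by exists y|right=> z zi]].
  by apply: no; exists z.
case: max => [mE|/(_ z) //]; subst m.
by exists M.+1; split=> //; split; [exists z|left].
Qed.

Lemma ex_near_max_independent m r (y0 : 'I_m -> D) :
    independent y0 -> (forall x, '[k x] <= r) ->
  exists2 y : 'I_m -> D, independent y & forall z : 'I_m -> D,
    `|\det (gram form (k \o z))| <= 2 * `|\det (gram form (k \o y))|.
Proof.
move=> y0i kr.
pose F (z : 'I_m -> D) := complex.Re `|\det (gram form (k \o z))|.
have FE z : `|\det (gram form (k \o z))| = (F z)%:C by [].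
have F0 z : (0 < F z) = (\det (gram form (k \o z)) != 0).
  by rewrite -normr_gt0 FE -(rmorph0 (real_complex R)) ltcR.
have bound z : F z <= m`!%:R * complex.Re r ^+ m.
  (* For [m = 0] there may be no point from which to read off [0 <= r], and the determinant is 1. *)
  case: m => [|m] in y0 y0i F FE F0 z *.
    by rewrite -lecR -FE det_mx00 normr1 expr0 mulr1 rmorph_nat.
  have r0 : 0 <= r by exact: le_trans (dnorm_ge0 form _) (kr (z ord0)).
  rewrite -lecR -FE rmorphM rmorph_nat rmorphXn /= RRe_real ?ger0_real //.
  by apply: norm_det_gram_le => // i; exact: kr.
have [|y yp ymax] := ex_near_max (z0 := y0) _ bound.
  by rewrite F0 -unitfE -unitmxE.
exists y; first by rewrite /independent unitmxE unitfE -F0.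
by move=> z; rewrite !FE -(rmorph_nat (real_complex R)) -rmorphM lecR.
Qed.

Definition cons_point m (x : D) (y : 'I_m -> D) (i : 'I_m.+1) : D :=
  oapp y x (unlift ord0 i).

Lemma cons_point0 m x (y : 'I_m -> D) : cons_point x y ord0 = x.
Proof. by rewrite /cons_point unlift_none. Qed.

Lemma cons_point_lift m x (y : 'I_m -> D) i :
  cons_point x y (lift ord0 i) = y i.
Proof. by rewrite /cons_point liftK. Qed.

Lemma ex_sampling_points n (r e : C) (L : {linear U -> 'cV[C]_n}) :
    (0 < n)%N -> 0 <= e -> (forall x, '[k x] <= r) ->
    (forall u x, L u = 0 -> `|'[u, k x]| ^+ 2 <= e * '[u]) ->
  exists m, (m <= 2 * n)%N /\ exists2 y : 'I_m -> D, independent y &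
    forall x, exists a : 'rV[C]_m, '[k x - lincomb (k \o y) a] <= 8 * e.
Proof.
move=> n0 e0 kr Le.
have [m [mn [[y0 y0i] mmax]]] := ex_maximal_independent (2 * n).
have [y yi ymax] := ex_near_max_independent y0i kr.
(* Let [k x] be farther than [8 * e], in squared distance, from the span of the chosen sections, and
   add [x] to the points. *)
exists m; split=> //; exists y => // x; apply: contrapT => bad.
pose z := cons_point x y; pose f := k \o z.
have flift : f \o lift ord0 = k \o y.
  by apply/funext => i; rewrite /f /z /= cons_point_lift.
have t0 : 0 <= 8 * e by rewrite mulr_ge0.
have gu : gram form (f \o lift ord0) \in unitmx by rewrite flift.
have dist_f (a : 'rV[C]_m.+1) : a 0 ord0 = 1 -> 8 * e < '[lincomb f a].
  move=> a1; rewrite real_ltNge ?ger0_real //; apply/negP => le; apply: bad.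
  exists (\row_j - a 0 (lift ord0 j)).
  suff -> : k x - lincomb (k \o y) (\row_j - a 0 (lift ord0 j)) =
    lincomb f a by [].
  rewrite /lincomb big_ord_recl a1 scale1r /f /= /z cons_point0 -sumrN.
  congr (_ + _).
  by apply: eq_bigr => j _; rewrite mxE scaleNr opprK /= cons_point_lift.
have Gu := gram_extend t0 gu dist_f.
(* The enlarged family is independent, so the family was not maximal and [m = 2 * n]. *)
case: mmax => [mE|/(_ z)]; last by apply; exact: Gu.
have vol i : `|\det (gram form (f \o lift i))| <=
    2 * `|\det (gram form (f \o lift ord0))|.
  by rewrite flift; exact: ymax.
have diag := gram_maxvol t0 gu dist_f vol.
pose M : 'M[C]_(m.+1, n) := \matrix_(i, j) L (f i) j 0.
have LM a : (L (lincomb f a))^T = a *m M.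
  apply/rowP => j; rewrite !mxE linear_sum summxE; apply: eq_bigr => i _.
  by rewrite linearZ !mxE.
(* The constant 8 turns the diagonal bound into [2 / 8 = (1 / 2) ^+ 2]. The result
   [n + 1 <= (2 * n + 1) / 2] is absurd. *)
have dim : (m.+1 - n)%:R <= m.+1%:R * 2^-1 :> C.
  apply: (gram_dim_le (form := form) (f := f) Gu (M := M) (e := e)) => //.
  - move=> a aM i; apply: Le; apply/trmx_inj.
    by rewrite LM aM trmx0.
  move=> i; rewrite -(ler_pM2r (_ : 0 < 8)) // -mulrA (mulrC e).
  apply: le_trans (diag i) _; rewrite le_eqVlt; apply/orP; left; apply/eqP.
  by field.
move: dim; rewrite ler_pdivlMr // -natrM ler_nat mE.
by rewrite mul2n -addnn -addSn addnK; lia.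
Qed.
End Points.

(** * The linear reconstruction map from samples *)

Section SamplingOperator.
Variables (R : realType) (D : Type) (m M : nat) (mM : (m <= M)%N).
Local Notation F := R[i].
Variable c : D -> 'rV[F]_m.

(** Only the first [m] of the [M] samples enter, since fewer than [M] independent sections may
    exist. *)
Definition sampling_op (v : 'cV[F]_M) : D -> F :=
  fun x => \sum_j c x 0 j * v (widen_ord mM j) 0.

Lemma sampling_op_is_linear : linear sampling_op.
Proof.
move=> b u v; apply/funext => x; rewrite /sampling_op.
rewrite [RHS]/GRing.add /= [in RHS]/GRing.scale /= [in RHS]/GRing.scale /=.
rewrite big_distrr -big_split /=.
by apply: eq_bigr => j _; rewrite !mxE; ring.
Qed.

HB.instance Definition _ :=
  GRing.isLinear.Build F 'cV[F]_M (D -> F) _ sampling_op sampling_op_is_linear.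
End SamplingOperator.

(** * Comparison of sampling and Gelfand widths in the RKHS *)

Section RKHS.
Variables (R : realType) (D : Type).
Local Notation C := R[i].
Variables (K : D -> D -> C) (H : rkhs K).
Local Notation "''[' u , v ]" := (rkhs_dot H u%R v%R) : ring_scope.
Local Notation "''[' u ]" := '[u, u] : ring_scope.
Local Notation normc := (@ComplexField.Normc.normc R).

Lemma ex_kernel_section : exists k : D -> H,
  (forall x, '[k x] = K x x) /\ forall x f, rkhs_eval H f x = '[f, k x].
Proof.
have /choice[k kP] : forall x, exists k : H,
    rkhs_eval H k = (fun y => K y x) /\ forall f, rkhs_eval H f x = '[f, k].
  by move=> x; have [k] := rkhs_reproducing H x; exists k.
exists k; split=> x; last by have [] := kP x.
by have [kx <-] := kP x; rewrite kx.
Qed.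

Lemma bounded_sampling_op m M (mM : (m <= M)%N) (c : D -> 'rV[C]_m)
    (b : 'I_m -> C) :
    (forall j, 0 <= b j) -> (forall x j, `|c x 0 j| <= b j) ->
  forall v, bounded_fun (sampling_op mM c v : D -> C^o).
Proof.
move=> b0 cb v.
pose B := \sum_j b j * `|v (widen_ord mM j) 0|.
exists B; split.
  by rewrite ger0_real // sumr_ge0 // => j _; rewrite mulr_ge0.
move=> B' BB' x _ /=; apply: le_trans (ltW BB').
apply: le_trans (ler_norm_sum _ _ _) _; apply: ler_sum => j _.
by rewrite normrM ler_wpM2r.
Qed.

Lemma sampling_width_le n (L : {linear H -> 'cV[C]_n}) (r e : R) (x0 : D) :
    (0 < n)%N -> 0 <= e ->
    (forall x, K x x <= (r ^+ 2)%:C) ->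
    (forall u x, L u = 0 -> `|rkhs_eval H u x| <= e%:C * `|u|) ->
  (linear_sampling_width H (2 * n) <= (Num.sqrt 8 * e)%:E)%E.
Proof.
move=> n0 e0 Kr Le; have [k [kK kE]] := ex_kernel_section.
have kr x : '[k x] <= (r ^+ 2)%:C by rewrite kK.
have e20 : 0 <= (e ^+ 2)%:C :> C by rewrite ler0c sqr_ge0.
have Le2 u x : L u = 0 -> `|'[u, k x]| ^+ 2 <= (e ^+ 2)%:C * '[u].
  move=> /(Le _ x); rewrite kE -rkhs_normE rmorphXn -exprMn => le.
  by rewrite ler_sqr ?nnegrE // mulr_ge0 // ler0c.
have [m [mn [y yi /choice[a aP]]]] := ex_sampling_points n0 e20 kr Le2.
(* Pairing [f] with a combination of sections conjugates its coefficients. The points are then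
   padded to [2 * n] by [x0]. *)
pose c x : 'rV[C]_m := a x ^ (@Num.conj C).
pose X (i : 'I_(2 * n)) : D := oapp y x0 (insub (val i)).
have Xy j : X (widen_ord mn j) = y j.
  by rewrite /X /= (_ : insub _ = Some j) // valK.
pose G := invmx (gram (rkhs_dot H) (k \o y)).
(* The approximant is [k x] minus the remainder, so the parallelogram law bounds it uniformly in
   [x]; this keeps the reconstruction bounded. *)
pose B : C := 2 * ((r ^+ 2)%:C + 8 * (e ^+ 2)%:C).
have aB x : '[lincomb (k \o y) (a x)] <= B.
  rewrite -[lincomb _ _](subKr (k x)).
  apply: le_trans (dnormB_le _ _ _) _.
  by rewrite ler_pM2l // lerD // aP.
have B0 : 0 <= B by rewrite mulr_ge0 ?addr_ge0 ?mulr_ge0 // ler0c sqr_ge0.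
have G0 j : 0 <= G j j := ltW (invmx_gram_gt0 yi j).
have b0 j : 0 <= 1 + G j j * B.
  by apply: addr_ge0; [exact: ler01 | exact: mulr_ge0].
(* Either the modulus is at most 1 or it is at most its square, which avoids a square root. *)
have cb x j : `|c x 0 j| <= 1 + G j j * B.
  rewrite mxE norm_conjC.
  have le : `|a x 0 j| ^+ 2 <= G j j * B.
    apply: le_trans (coef_lincomb_le yi (a x) j) _.
    exact: ler_wpM2l.
  have [le1|ge1] := real_leP (normr_real (a x 0 j)) (@real1 C).
    by rewrite (le_trans le1) // lerDl (le_trans _ le) ?exprn_ge0.
  rewrite (le_trans (_ : _ <= `|a x 0 j| ^+ 2)) //.
    by rewrite ler_eXnr // ltW.
  by rewrite (le_trans le) // lerDr.
pose w := ereal_sup [set supnorm (rkhs_eval H f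
   - sampling_op mn c (\col_i rkhs_eval H f (X i))) | f in unit_ball (H := H)].
apply: ge_ereal_inf; exists w.
  by exists X, (sampling_op mn c); split=> //; exact: bounded_sampling_op b0 cb.
apply: ge_ereal_sup => _ [f f1 <-]; apply: ge_ereal_sup => _ [x _ <-].
have fx : (rkhs_eval H f - sampling_op mn c (\col_i rkhs_eval H f (X i))) x =
    '[f, k x - lincomb (k \o y) (a x)].
  rewrite [LHS]/GRing.add /= kE linearBr; congr (_ - _).
  rewrite /sampling_op /lincomb linear_sumr; apply: eq_bigr => j _.
  by rewrite [RHS]dotZr !mxE kE Xy.
rewrite fx lee_fin -lecR -[leLHS]/(`|'[f, k x - lincomb (k \o y) (a x)]|).
have s0 : 0 <= (Num.sqrt 8 * e)%:C :> C by rewrite ler0c mulr_ge0 ?sqrtr_ge0.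
rewrite -ler_sqr ?nnegrE // (le_trans (dot_CauchySchwarz _ _ _)) //.
rewrite -rmorphXn exprMn sqr_sqrtr //= rmorphM rmorph_nat.
rewrite -[leRHS]mul1r ler_pM // -rkhs_normE.
by rewrite expr_le1.
Qed.

Lemma kernel_boundP (x0 : D) : (kernel_bound K < +oo)%E ->
  exists2 r : R, kernel_bound K = r%:E &
    0 <= r /\ forall x, K x x <= (r ^+ 2)%:C.
Proof.
move=> hK; have [k [kK _]] := ex_kernel_section.
have ub x : ((Num.sqrt (complex.Re (K x x)))%:E <= kernel_bound K)%E.
  by apply: ereal_sup_ubound; exists x.
(* The point [x0] excludes the value [-oo] of an empty supremum. *)
have fin : kernel_bound K \is a fin_num.
  by rewrite fin_numElt hK andbT (lt_le_trans _ (ub x0)) ?ltNyr.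
have rE := fineK fin; exists (fine (kernel_bound K)) => //.
have {}ub x : Num.sqrt (complex.Re (K x x)) <= fine (kernel_bound K).
  by rewrite -lee_fin rE.
split=> [|x]; first exact: le_trans (sqrtr_ge0 _) (ub x0).
have Kx0 : 0 <= K x x by rewrite -kK dnorm_ge0.
rewrite -[K x x]RRe_real ?ger0_real // lecR.
have Re0 : 0 <= complex.Re (K x x).
  by rewrite -ler0c RRe_real ?ger0_real.
rewrite -[leLHS]sqr_sqrtr // ler_sqr ?nnegrE ?sqrtr_ge0 //.
exact: le_trans (sqrtr_ge0 _) (ub x).
Qed.

Lemma eval_le (r : R) : 0 <= r -> (forall x, K x x <= (r ^+ 2)%:C) ->
  forall f x, `|rkhs_eval H f x| <= r%:C * `|f|.
Proof.
move=> r0 Kr f x; have [k [kK kE]] := ex_kernel_section.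
rewrite kE -ler_sqr ?nnegrE ?normr_ge0 ?mulr_ge0 ?normr_ge0 ?ler0c //.
apply: le_trans (dot_CauchySchwarz _ _ _) _.
rewrite exprMn rkhs_normE mulrC -rmorphXn kK.
by apply: ler_wpM2r; [exact: dnorm_ge0 | exact: Kr].
Qed.

Lemma eval_le_unit_ball (L : H -> Prop) (e : R) :
    (forall a f, L f -> L (a *: f)) ->
    (forall f x, L f -> unit_ball f -> normc (rkhs_eval H f x) <= e) ->
  forall f x, L f -> `|rkhs_eval H f x| <= e%:C * `|f|.
Proof.
move=> LZ Le f x Lf.
have [->|f0] := eqVneq f 0; first by rewrite linear0 !normr0 mulr0.
have nf : 0 < `|f| by rewrite normr_gt0.
have := Le (`|f|^-1 *: f) x (LZ _ _ Lf).
rewrite /unit_ball /= normrZ normfV normr_id mulVf ?gt_eqF // => /(_ (lexx _)).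
rewrite -lecR -[leLHS]/(`|rkhs_eval H (`|f|^-1 *: f) x|) linearZ /=.
rewrite [X in `|X|]/GRing.scale /=.
rewrite normrM normfV normr_id mulrC.
by rewrite ler_pdivrMr.
Qed.

(* Both [f] and [- f] carry zero information, so the error on one of them is
   at least the value of [f]. *)
Lemma gelfand_ker n (N : {linear H -> 'cV[C]_n}) (psi : 'cV[C]_n -> D -> C)
    f x :
    N f = 0 -> unit_ball f ->
  ((normc (rkhs_eval H f x))%:E <=
    ereal_sup [set supnorm (rkhs_eval H f - psi (N f))%R
              | f in unit_ball (H := H)])%E.
Proof.
move=> Nf f1; set E := ereal_sup _.
have ub g : N g = 0 -> unit_ball g ->
    ((normc (rkhs_eval H g x - psi 0 x)%R)%:E <= E)%E.
  move=> Ng g1; apply: (@le_trans _ _ (supnorm (rkhs_eval H g - psi (N g)))).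
    by rewrite Ng; apply: ereal_sup_ubound; exists x.
  by apply: ereal_sup_ubound; exists g.
set z := rkhs_eval H f x; set p := psi 0 x.
have le1 : ((normc (z - p)%R)%:E <= E)%E := ub f Nf f1.
have le2 : ((normc (- z - p)%R)%:E <= E)%E.
  have -> : - z = rkhs_eval H (- f) x by rewrite linearN.
  by apply: ub; [rewrite linearN /= Nf oppr0 | rewrite /unit_ball /= normrN].
have [le|le] := leP (normc z) (normc (z - p)).
  by apply: le_trans le1; rewrite lee_fin.
apply: le_trans le2; rewrite lee_fin.
have : (normc z)%:C *+ 2 <= (normc (z - p))%:C + (normc (- z - p))%:C.
  change (`|z| *+ 2 <= `|z - p| + `|- z - p|).
  rewrite -normrMn (_ : z *+ 2 = (z - p) - (- z - p)); first exact: ler_normB.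
  by ring.
by rewrite -rmorphMn -rmorphD lecR; lra.
Qed.

(** Zero information has all of [H] as kernel, where [r] bounds point evaluation. *)
Lemma linear_sampling_width_le n (r : R) (x0 : D) :
    (0 < n)%N -> 0 <= r -> (forall x, K x x <= (r ^+ 2)%:C) ->
  (linear_sampling_width H (2 * n) <= (Num.sqrt 8)%:E * r%:E)%E.
Proof.
move=> n0 r0 Kr.
apply: (sampling_width_le (L := \0 : {linear H -> 'cV[C]_n}) x0 n0 r0 Kr).
by move=> u x _; apply: eval_le.
Qed.

Lemma gelfand_error_ge0 n (N : {linear H -> 'cV[C]_n})
    (psi : 'cV[C]_n -> D -> C) (x : D) :
  (0 <= ereal_sup [set supnorm (rkhs_eval H f - psi (N f))%R
                  | f in unit_ball (H := H)])%E.
Proof.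
apply: le_trans (gelfand_ker psi (f := 0) x _ _).
- by rewrite lee_fin -ler0c; exact: (normr_ge0 (rkhs_eval H 0 x)).
- by rewrite linear0.
by rewrite /unit_ball /= normr0 ler01.
Qed.

Lemma gelfand_width_ge0 n (x : D) : (0 <= gelfand_width H n)%E.
Proof.
by apply: le_ereal_inf_tmp => _ [N [psi [_ _ ->]]]; exact: gelfand_error_ge0.
Qed.

Lemma sampling_le_gelfand n (r : R) (x0 : D) :
    (0 < n)%N -> 0 <= r -> (forall x, K x x <= (r ^+ 2)%:C) ->
  (linear_sampling_width H (2 * n) <= (Num.sqrt 8)%:E * gelfand_width H n)%E.
Proof.
move=> n0 r0 Kr.
have s0 : 0 < Num.sqrt 8 :> R by rewrite sqrtr_gt0.
rewrite -lee_pdivrMl //; apply: le_ereal_inf_tmp => _ [N [psi [_ _ ->]]].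
rewrite lee_pdivrMl //.
have ub := @gelfand_ker n N psi; have := gelfand_error_ge0 N psi x0.
(* An infinite error makes the bound trivial; a finite one bounds point evaluation on the kernel of
   [N]. *)
set E := ereal_sup _ in ub *; case: E ub => [e||] ub // e0; last first.
  by rewrite gt0_muley ?lte_fin // leey.
apply: (sampling_width_le (L := N) x0 n0 _ Kr); first by rewrite -lee_fin.
move=> u x; apply: (@eval_le_unit_ball (fun f => N f = 0)).
  by move=> a f Nf; rewrite linearZ /= Nf scaler0.
by move=> f y Nf f1; rewrite -lee_fin ub.
Qed.

Lemma widths_empty n : ~ inhabited D ->
  kernel_bound K = -oo%E /\ gelfand_width H n = -oo%E.
Proof.
move=> D0; have noD (x : D) : False by exact: D0 (inhabits x).
have sup0 (F : D -> \bar R) : ereal_sup [set F x | x in [set: D]] = -oo%E.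
  by rewrite (_ : [set _ | _ in _] = set0) ?ereal_sup0 // -subset0 => ? [x].
split; first exact: sup0.
apply/eqP; rewrite -leeNy_eq; apply: ge_ereal_inf.
exists (ereal_sup [set supnorm (rkhs_eval H f - (fun=> 0) : D -> C)%R
                  | f in unit_ball (H := H)]).
  exists (\0 : {linear H -> 'cV[C]_n}), (fun=> fun=> 0); split=> //.
    by exists 0 => f; rewrite normr0 mul0r.
  by move=> v; exists 0; split => // M M0 x.
by apply: ge_ereal_sup => _ [f _ <-]; rewrite /supnorm sup0.
Qed.

End RKHS.

(* Combination of the two bounds *)
Local Close Scope ring_scope.
Local Open Scope ereal_scope.

Theorem theorem2p4 (R : realType) (D : Type) (K : D -> D -> R[i])
  (H : rkhs K) (hK : kernel_bound K < +oo) (n : nat) (hn : (0 < n)%N) :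
  linear_sampling_width H (2 * n)
    <= sqrte (8%:E * kernel_bound K * gelfand_width H n).
Proof.
have [[x0]|noD] := pselect (inhabited D); last first.
  (* Suprema over an empty domain are -oo, so the right-hand side is +oo. *)
  have [-> ->] := widths_empty H n noD.
  by rewrite (@gt0_muleNy _ 8%:E) ?lte_fin // mulNyNy leey.
have [r -> [r0 Kr]] := kernel_boundP H x0 hK.
have le1 := linear_sampling_width_le H x0 hn r0 Kr.
have le2 := sampling_le_gelfand H x0 hn r0 Kr.
have c0 := gelfand_width_ge0 H n x0.
move: (linear_sampling_width H (2 * n)) (gelfand_width H n) le1 le2 c0 => g c.
move=> le1 le2 c0.
have [g0|/ltW g0] := leP g 0; first by rewrite (le_trans g0) // sqrte_ge0.
rewrite -[g]gee0_abs // -sqrte_sqr lee_sqrt; last first.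
  by rewrite !mule_ge0 // lee_fin.
(* One factor of [g ^+ 2] is bounded through [r], the other through [c]; the two roots of 8 multiply
   to 8. *)
apply: le_trans (lee_pmul g0 g0 le1 le2) _.
by rewrite muleACA -EFinM -expr2 sqr_sqrtr // muleA.
Qed.
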